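(* (i) Let $t$ be a rational number, $t\neq0,\pm1,\pm2$, and let $f_t(x)=(x+t)^2-2-t$. The set of primes $p\in\Pi(t)$ which divide the numerator of $f_t^n(0)$ for some $n\ge1$ (where $f_t^n$ is the $n$-th iterate of $f_t$) is equal to $\Pi_0(t,2)$. (ii) Let $s$ be a rational number, $s\ne0,\pm1$, let $t=s+s^{-1}$ and let $g_s(x)=(x+s)^2-s$. The set of odd primes $p$, not dividing the numerator or the denominator of $s$, which divide the numerator of $g_s^n(0)$ for some $n\ge1$ is equal to $\Pi_0(t,2)$.
   Context: For rational $t$ put $D_t=\begin{pmatrix}0&-1\\1&t\end{pmatrix}$. $\Pi(t)$ is the set of primes $p\ge3$ not dividing the denominator of $t$. For $p\in\Pi(t)$ the index $\chi(t,p)$ is the smallest integer $k\ge1$ with $D_t^k\equiv I\pmod p$. $\Pi_0(t,2)=\{p\in\Pi(t): \chi(t,p)\text{ is odd}\}$. Numerators and denominators refer to rational numbers in lowest terms. *)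

(* Defs.v *)
From mathcomp Require Import all_boot all_order all_algebra.
From mathcomp Require Import classical_sets.

Set Implicit Arguments.
Unset Strict Implicit.
Unset Printing Implicit Defensive.

Import Order.TTheory GRing.Theory Num.Theory.

Local Open Scope classical_set_scope.
Local Open Scope ring_scope.

Definition divides_num (p : nat) (x : rat) : bool := (p%:Z %| numq x)%Z.
Definition divides_den (p : nat) (x : rat) : bool := (p%:Z %| denq x)%Z.

(* For p prime, x = y mod p means x - y \in p Z_(p), the maximal ideal of the  *)
(* localization of Z at p.  As numq / denq is in lowest terms, this says that  *)
(* p divides the numerator of x - y.                                           *)
Definition eq_rat_mod (p : nat) (x y : rat) : bool := divides_num p (x - y).

Definition eq_mx_mod (p : nat) (A B : 'M[rat]_2) : Prop :=
  forall i j, eq_rat_mod p (A i j) (B i j).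

Definition Dmx (t : rat) : 'M[rat]_2 :=
  \matrix_(i < 2, j < 2) nth 0 (nth [::] [:: [:: 0; -1]; [:: 1; t]] i) j.

Definition Pi (t : rat) : set nat :=
  [set p : nat | [/\ prime p, (3 <= p)%N & ~~ divides_den p t]].

Definition is_index (t : rat) (p k : nat) : Prop :=
  [/\ (1 <= k)%N,
      eq_mx_mod p (Dmx t ^+ k) 1 &
      forall j : nat, (1 <= j)%N -> eq_mx_mod p (Dmx t ^+ j) 1 -> (k <= j)%N].

(* The default value 0 is used only when no index exists; this never happens   *)
(* for p in Pi t, since the reduction of Dmx t then lies in the finite group   *)
(* SL_2(F_p).                                                                  *)
Definition chi (t : rat) (p : nat) : nat := xget 0%N [set k | is_index t p k].

Definition Pi0_2 (t : rat) : set nat := [set p | Pi t p /\ odd (chi t p)].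

Definition f (t x : rat) : rat := (x + t) ^+ 2 - 2 - t.

Definition g (s x : rat) : rat := (x + s) ^+ 2 - s.

(* Main.v *)
Require Import Defs.
From mathcomp Require Import all_boot all_order all_algebra.
From mathcomp Require Import classical_sets.
From mathcomp Require Import cyclic ring.

Import Order.TTheory GRing.Theory Num.Theory.

Local Open Scope classical_set_scope.
Local Open Scope ring_scope.

(** Translation turns both maps into simple ones: in the variable y = x + t the
    map f t is y |-> y^2 - 2 with starting point t (iter_fE), and in y = x + s
    the map g s is y |-> y^2 with starting point s (iter_gE).  Hence p divides
    the numerator of an iterate exactly when, in F_p, an iterate of the new
    map returns to its starting point.

    For squaring, sigma^(2^n) = sigma with n >= 1 says that sigma has odd
    order, because 2 is invertible modulo every odd number.  The map y^2 - 2
    is squaring seen through traces: in an F_p-algebra, if x y = y x = 1 and x + y = tau, then its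
    n-th iterate at tau is x^(2^n) + y^(2^n) (iter_dbl).  If x has odd order,
    some such sum equals x + y.  Conversely, put N = 2^n and suppose that
    x^N + y^N = x + y; then
      (x^N - x) (x^N - y) = 0,  that is,  (x^(N-1) - 1) (x^(N+1) - 1) = 0.
    Both exponents are odd and divide k = (N - 1)(N + 1), so (x^k - 1)^2 = 0.
    Over F_p this gives x^(k p) = (x^k - 1)^p + 1 = 1, and k p is odd.  This
    treats uniformly the matrices with distinct eigenvalues and those with a
    double eigenvalue, whose order is divisible by p unless they are scalar.

    The equivalence (odd_order_iter_dbl) holds in every F_p-algebra, p odd.  For the
    companion matrix D of trace tau it relates the parity of the index of D to
    the orbit of tau, which is part (i).  For the scalar sigma it relates
    the order of sigma to the orbit of tau = sigma + sigma^-1; combined with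
    part (i) for this tau, it gives part (ii). *)

(** * Odd multiplicative order and iterates of y^2 - 2 *)

Definition has_odd_order {R : pzRingType} (x : R) : Prop :=
  exists2 k : nat, odd k & x ^+ k = 1.

(** The trace of x^2 in terms of the trace y of x, for x of determinant 1. *)
Definition dbl {R : pzRingType} (y : R) : R := y ^+ 2 - 2.

(** By Euler's theorem, 2 ^ totient k is 1 modulo the odd number k. *)
Lemma odd_order_fixed_expr2 {R : pzRingType} {x : R} {k : nat} :
  odd k -> x ^+ k = 1 -> x ^+ (2 ^ totient k) = x.
Proof.
move=> odd_k xk1.
have k_gt0 : (0 < k)%N by case: k odd_k {xk1}.
have : (k %| 2 ^ totient k - 1)%N.
  rewrite -eqn_mod_dvd ?expn_gt0 //.
  by apply/eqP/Euler_exp_totient; rewrite coprime2n.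
case/dvdnP=> q Eq.
have -> : (2 ^ totient k = k * q + 1)%N.
  by rewrite mulnC -Eq subnK // expn_gt0.
by rewrite exprD exprM xk1 expr1n mul1r expr1.
Qed.

Lemma fixed_expr2_odd_order {R : pzRingType} {x y : R} {n : nat} :
  x * y = 1 -> (0 < n)%N -> x ^+ (2 ^ n) = x -> has_odd_order x.
Proof.
move=> xy1 n_gt0 xE; exists (2 ^ n).-1.
  have : odd (2 ^ n).-1.+1 = false.
    by rewrite prednK ?expn_gt0 // oddX orbF eqn0Ngt n_gt0.
  by move=> /= /negbFE.
by rewrite -[LHS]mulr1 -xy1 mulrA -exprSr prednK ?expn_gt0 // xE.
Qed.

(** Because x^m y^m = 1, squaring x^m + y^m gives x^(2m) + y^(2m) + 2. *)
Lemma iter_dbl {F : fieldType} {A : algType F} {x y : A} {tau : F} (n : nat) :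
  x * y = 1 -> y * x = 1 -> x + y = tau%:A ->
  (iter n dbl tau)%:A = x ^+ (2 ^ n) + y ^+ (2 ^ n).
Proof.
move=> xy1 yx1 xyE.
have cxy : GRing.comm x y by rewrite /GRing.comm xy1 yx1.
elim: n => [|n IHn]; first by rewrite !expr1 xyE.
have XY1 : x ^+ (2 ^ n) * y ^+ (2 ^ n) = 1 by rewrite -exprMn_comm // xy1 expr1n.
have YX1 : y ^+ (2 ^ n) * x ^+ (2 ^ n) = 1.
  by rewrite -exprMn_comm // ?yx1 ?expr1n.
rewrite iterS {1}/dbl scalerBl -[2]/(1 + 1) scalerDl scale1r.
rewrite expr2 -scalerA -[X in _ *: X]mul1r scalerAl IHn.
by rewrite mulrDl !mulrDr XY1 YX1 -!exprD addnn -mul2n -expnS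
  (addrC 1 (y ^+ _)) addrACA addrK.
Qed.

(** In characteristic p, x^p - 1 = (x - 1)^p, and p >= 2. *)
Lemma expr_pchar_unipotent {R : nzRingType} {p : nat} {x : R} :
  p \in [pchar R] -> (x - 1) ^+ 2 = 0 -> x ^+ p = 1.
Proof.
move=> pR x1.
have p_ge2 : (2 <= p)%N by apply: prime_gt1; case/andP: pR.
have := pFrobenius_autB_comm pR (commr1 x).
rewrite !pFrobenius_autE expr1n -(subnK p_ge2) exprD x1 mulr0 subnK //.
by move/eqP; rewrite eq_sym subr_eq0 => /eqP.
Qed.

(** The element x^N, with N = 2^n, is a root of X^2 - (x + y) X + 1, which
    factors as (X - x)(X - y). *)
Lemma odd_order_of_trace {R : nzRingType} {p n : nat} {x y : R} :
  odd p -> p \in [pchar R] -> x * y = 1 -> y * x = 1 -> (0 < n)%N ->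
  x ^+ (2 ^ n) + y ^+ (2 ^ n) = x + y -> has_odd_order x.
Proof.
move=> odd_p pR xy1 yx1 n_gt0 trE.
have cxy : GRing.comm x y by rewrite /GRing.comm xy1 yx1.
set N := (2 ^ n)%N in trE.
have N_gt0 : (0 < N)%N by rewrite expn_gt0.
have even_N : odd N = false by rewrite oddX orbF eqn0Ngt n_gt0.
have XY1 : x ^+ N * y ^+ N = 1 by rewrite -exprMn_comm // xy1 expr1n.
have prod0 : (x ^+ N.-1 - 1) * (x ^+ N.+1 - 1) = 0.
  have -> : x ^+ N.+1 - 1 = (x ^+ N - y) * x by rewrite mulrBl -exprSr yx1.
  have -> : x ^+ N.-1 - 1 = y * (x ^+ N - x).
    by rewrite mulrBr yx1 -{2}(prednK N_gt0) exprS mulrA yx1 mul1r.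
  have quad : x ^+ N * x ^+ N = x ^+ N * x + x ^+ N * y - 1.
    by rewrite -mulrDr -trE mulrDr XY1; apply/esym/addrK.
  have cross0 : (x ^+ N - x) * (x ^+ N - y) = 0.
    rewrite mulrBl !mulrBr xy1 quad -exprS exprSr.
    by rewrite (addrAC _ (- 1)) addrK subrr.
  by rewrite mulrA -(mulrA y) cross0 mulr0 mul0r.
set k := (N.-1 * N.+1)%N.
have odd_k : odd k.
  by rewrite /k oddM /= even_N -subn1 oddB // even_N.
exists (k * p)%N; first by rewrite oddM odd_k.
rewrite exprM; apply: (expr_pchar_unipotent pR _).
(* each of the two factors divides x^k - 1, so their product divides its
   square *)
have [S xkE] : exists S, x ^+ k - 1 = (x ^+ N.+1 - 1) * S.
  by eexists; rewrite /k mulnC exprM subrX1.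
have [S' xkE'] : exists S', x ^+ k - 1 = S' * (x ^+ N.-1 - 1).
  exists (\sum_(i < N.+1) (x ^+ N.-1) ^+ i); rewrite /k exprM subrX1.
  apply: commr_sum => i _; apply: commrX; apply: commr_sym.
  exact: (commrB (commr_refl _) (commr1 _)).
by rewrite expr2 {1}xkE' xkE mulrA -(mulrA S') prod0 mulr0 mul0r.
Qed.

(** Taking A to be a matrix algebra or the field itself gives the two uses: A is
    non-commutative in general, so x and y need not be scalars. *)
Lemma odd_order_iter_dbl {F : fieldType} {A : algType F} {p : nat} {x y : A}
    {tau : F} :
  odd p -> p \in [pchar F] -> x * y = 1 -> y * x = 1 -> x + y = tau%:A ->
  has_odd_order x <-> exists2 n : nat, (0 < n)%N & iter n dbl tau = tau.
Proof.
move=> odd_p pF xy1 yx1 xyE.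
have pA : p \in [pchar A] by rewrite pchar_lalg.
split=> [[k odd_k xk1] | [n n_gt0 tauE]]; last first.
  apply: (odd_order_of_trace odd_p pA xy1 yx1 n_gt0 _).
  by rewrite -(iter_dbl n xy1 yx1 xyE) tauE xyE.
have k_gt0 : (0 < k)%N by case: k odd_k {xk1}.
exists (totient k); first by rewrite totient_gt0.
have yk1 : y ^+ k = 1.
  have cxy : GRing.comm x y by rewrite /GRing.comm xy1 yx1.
  by rewrite -[LHS]mul1r -xk1 -exprMn_comm // xy1 expr1n.
apply: (fmorph_inj (in_alg A)); rewrite /= (iter_dbl _ xy1 yx1 xyE).
by rewrite !odd_order_fixed_expr2.
Qed.

(** * Reduction of p-integral rationals to F_p *)

Lemma intr_Fp_eq0 (p : nat) (m : int) :
  prime p -> (m%:~R == 0 :> 'F_p) = (p %| m)%Z.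
Proof. by move=> p_pr; rewrite -(dvdz_pcharf (pchar_Fp p_pr)). Qed.

(** For p prime, the graph of the ring morphism from the localization of Z at p to F_p.
    Allowing every fraction u / v with v prime to p, not only the reduced one,
    makes compatibility with the ring operations immediate. *)
Definition reduces {p : nat} (x : rat) (a : 'F_p) : Prop :=
  exists u v : int,
    [/\ v%:~R != 0 :> 'F_p, x = u%:~R / v%:~R & a = u%:~R / v%:~R].

Lemma denom_neq0 {p : nat} {v : int} :
  v%:~R != 0 :> 'F_p -> v%:~R != 0 :> rat.
Proof. by apply: contra_neq => /eqP; rewrite intr_eq0 => /eqP ->. Qed.

Lemma reduces_int (p : nat) (m : int) : reduces m%:~R (m%:~R : 'F_p).
Proof. by exists m, 1; rewrite oner_neq0 !divr1. Qed.

Lemma reduces0 (p : nat) : reduces 0 (0 : 'F_p).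
Proof. exact: (reduces_int p 0). Qed.

Lemma reduces1 (p : nat) : reduces 1 (1 : 'F_p).
Proof. exact: (reduces_int p 1). Qed.

Lemma reducesD {p : nat} {x y : rat} {a b : 'F_p} :
  reduces x a -> reduces y b -> reduces (x + y) (a + b).
Proof.
move=> [u [v [v0 -> ->]]] [u' [v' [v'0 -> ->]]].
exists (u * v' + u' * v), (v * v').
rewrite !rmorphD !rmorphM; split; first by rewrite mulf_neq0.
  by field; rewrite !(denom_neq0 v0, denom_neq0 v'0).
by field; rewrite v0 v'0.
Qed.

Lemma reducesN {p : nat} {x : rat} {a : 'F_p} :
  reduces x a -> reduces (- x) (- a).
Proof.
move=> [u [v [v0 -> ->]]].
by exists (- u), v; rewrite !rmorphN !mulNr.
Qed.

Lemma reducesM {p : nat} {x y : rat} {a b : 'F_p} :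
  reduces x a -> reduces y b -> reduces (x * y) (a * b).
Proof.
move=> [u [v [v0 -> ->]]] [u' [v' [v'0 -> ->]]].
exists (u * u'), (v * v').
by rewrite !rmorphM !invfM; split; rewrite ?mulf_neq0 // mulrACA.
Qed.

Lemma reducesV {p : nat} {x : rat} {a : 'F_p} :
  reduces x a -> a != 0 -> reduces x^-1 a^-1.
Proof.
move=> [u [v [v0 -> ->]]] a0.
exists v, u; rewrite !invf_div; split=> //.
by apply: contraNneq a0 => ->; rewrite mul0r.
Qed.

Lemma reducesB {p : nat} {x y : rat} {a b : 'F_p} :
  reduces x a -> reduces y b -> reduces (x - y) (a - b).
Proof. by move=> xa yb; apply: (reducesD xa (reducesN yb)). Qed.

Lemma reducesX {p : nat} {x : rat} {a : 'F_p} (n : nat) :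
  reduces x a -> reduces (x ^+ n) (a ^+ n).
Proof.
move=> xa; elim: n => [|n IHn]; first exact: reduces1.
by rewrite !exprS; apply: reducesM.
Qed.

Lemma reduces_iter_dbl {p : nat} {x : rat} {a : 'F_p} (n : nat) :
  reduces x a -> reduces (iter n dbl x) (iter n dbl a).
Proof.
move=> xa; elim: n => //= n IHn.
exact: (reducesB (reducesX 2 IHn) (reduces_int p 2)).
Qed.

Lemma numq_den {x : rat} {u v : int} :
  v != 0 -> x = u%:~R / v%:~R -> numq x * v = u * denq x.
Proof.
move=> v0 xE; apply: (intr_inj (R := rat)); rewrite !rmorphM /= numqE xE.
by field; rewrite intr_eq0.
Qed.

Lemma coprime_num_den_Fp {p : nat} (x : rat) : prime p ->
  ((numq x)%:~R != 0 :> 'F_p) || ((denq x)%:~R != 0 :> 'F_p).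
Proof.
move=> p_pr; rewrite -negb_and !intr_Fp_eq0 // !dvdzE /= -dvdn_gcd.
by rewrite (eqP (coprime_num_den x)) dvdn1; case: eqP p_pr => // ->.
Qed.

(** From numq x * v = u * denq x: if p divides denq x, then it divides numq x
    since v is prime to p, against coprimality. *)
Lemma reduces_den {p : nat} {x : rat} {a : 'F_p} :
  prime p -> reduces x a -> ~~ divides_den p x.
Proof.
move=> p_pr [u [v [v0 xE _]]]; rewrite /divides_den -intr_Fp_eq0 //.
apply/negP=> /eqP d0.
have := coprime_num_den_Fp x p_pr; rewrite d0 eqxx orbF.
have v0' : v != 0 by apply: contra_neq v0 => ->.
have /(congr1 (fun m : int => m%:~R : 'F_p)) := numq_den v0' xE.
by rewrite !rmorphM /= d0 mulr0 => /eqP; rewrite mulf_eq0 (negPf v0) orbF => ->.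
Qed.

Lemma reduces_num {p : nat} {x : rat} {a : 'F_p} :
  prime p -> reduces x a -> divides_num p x = (a == 0).
Proof.
move=> p_pr xa; have d0 := reduces_den p_pr xa.
rewrite /divides_den -intr_Fp_eq0 // in d0.
rewrite /divides_num -intr_Fp_eq0 //.
case: xa => u [v [v0 xE ->]].
have v0' : v != 0 by apply: contra_neq v0 => ->.
have /(congr1 (fun m : int => m%:~R : 'F_p)) := numq_den v0' xE.
rewrite !rmorphM /= mulf_eq0 invr_eq0 (negPf v0) orbF => E.
by rewrite -(mulIr_eq0 _ (mulIf v0)) E mulf_eq0 (negPf d0) orbF.
Qed.

Lemma reduces_exists {p : nat} {x : rat} :
  prime p -> ~~ divides_den p x -> exists a : 'F_p, reduces x a.
Proof.
move=> p_pr; rewrite /divides_den -intr_Fp_eq0 // => d0.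
exists ((numq x)%:~R / (denq x)%:~R), (numq x), (denq x).
by rewrite divq_num_den.
Qed.

Lemma reduces_eq {p : nat} {x y : rat} {a b : 'F_p} :
  prime p -> reduces x a -> reduces y b -> eq_rat_mod p x y = (a == b).
Proof.
move=> p_pr xa yb.
by rewrite /eq_rat_mod (reduces_num p_pr (reducesB xa yb)) subr_eq0.
Qed.

(** The denominator of s + s^-1 is, up to sign, numq s * denq s: the latter is
    coprime to numq s ^ 2 + denq s ^ 2. *)
Lemma den_addV {p : nat} {s : rat} :
  prime p -> s != 0 -> ~~ divides_den p (s + s^-1) ->
  ~~ divides_num p s && ~~ divides_den p s.
Proof.
move=> p_pr s0.
rewrite /divides_num /divides_den -!intr_Fp_eq0 // => d0.
rewrite -negb_or -mulf_eq0; apply/negP=> /eqP ab0.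
have n0 : numq s != 0 by rewrite numq_eq0.
have E : s + s^-1 = (numq s ^+ 2 + denq s ^+ 2)%:~R / (numq s * denq s)%:~R.
  rewrite -[in LHS](divq_num_den s) rmorphD !rmorphXn !rmorphM /=.
  by field; rewrite !intr_eq0 denq_eq0 n0.
have /(congr1 (fun m : int => m%:~R : 'F_p)) :=
  numq_den (mulf_neq0 n0 (denq_neq0 s)) E.
rewrite !rmorphM rmorphD !rmorphXn /= ab0 mulr0 => /esym/eqP.
rewrite mulf_eq0 (negPf d0) orbF => sum0.
have := coprime_num_den_Fp s p_pr; move/eqP: ab0 sum0.
rewrite mulf_eq0 => /orP[] /eqP ->;
  by rewrite expr0n ?addr0 ?add0r expf_eq0 /= => ->; rewrite ?eqxx.
Qed.

(** * The companion matrix and its index *)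

Definition companion {R : pzRingType} (t : R) : 'M[R]_2 :=
  \matrix_(i < 2, j < 2) nth 0 (nth [::] [:: [:: 0; -1]; [:: 1; t]] i) j.

(** The adjugate of companion t, hence its inverse, as the determinant is 1. *)
Definition companionV {R : pzRingType} (t : R) : 'M[R]_2 :=
  \matrix_(i < 2, j < 2) nth 0 (nth [::] [:: [:: t; 1]; [:: -1; 0]] i) j.

Lemma companion_mulV {R : comNzRingType} (t : R) :
  companion t * companionV t = 1.
Proof.
apply/matrixP=> i j; rewrite !mxE !big_ord_recl big_ord0 !mxE.
by case: i => [[|[|//]] ?]; case: j => [[|[|//]] ?] /=; ring.
Qed.

Lemma companion_Vmul {R : comNzRingType} (t : R) :
  companionV t * companion t = 1.
Proof.
apply/matrixP=> i j; rewrite !mxE !big_ord_recl big_ord0 !mxE.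
by case: i => [[|[|//]] ?]; case: j => [[|[|//]] ?] /=; ring.
Qed.

Lemma companion_addV {R : comNzRingType} (t : R) :
  companion t + companionV t = t%:A.
Proof.
apply/matrixP=> i j; rewrite !mxE.
by case: i => [[|[|//]] ?]; case: j => [[|[|//]] ?] /=; ring.
Qed.

Lemma companion_mod {p : nat} {t : rat} {tau : 'F_p} (k : nat) :
  prime p -> reduces t tau ->
  eq_mx_mod p (Dmx t ^+ k) 1 <-> companion tau ^+ k = 1.
Proof.
move=> p_pr ttau.
have entries i j : reduces ((Dmx t ^+ k) i j) ((companion tau ^+ k) i j).
  elim: k i j => [|k IHk] i j.
    by rewrite !expr0 !mxE; case: (i == j); [apply: reduces1|apply: reduces0].
  rewrite !exprS !mxE; apply: big_ind2 => [||l _]; first exact: reduces0.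
    by move=> *; apply: reducesD.
  apply: reducesM; last exact: IHk.
  rewrite !mxE; case: i => [[|[|//]] ?]; case: l => [[|[|//]] ?] //=.
  - exact: reduces0.
  - exact: (reducesN (reduces1 p)).
  - exact: reduces1.
have entries1 i j : reduces ((1 : 'M[rat]_2) i j) ((1 : 'M['F_p]_2) i j).
  by rewrite !mxE; case: (i == j); [apply: reduces1|apply: reduces0].
split=> [H|H i j]; last first.
  by rewrite (reduces_eq p_pr (entries i j) (entries1 i j)) H.
apply/matrixP=> i j; apply/eqP.
by rewrite -(reduces_eq p_pr (entries i j) (entries1 i j)).
Qed.

(** An odd index is itself an odd exponent killing D; conversely the index
    divides every exponent that kills D, so it is odd as soon as one is.  The
    default value 0 of chi is even, so an odd chi is a genuine index. *)
Lemma odd_chi {p : nat} {t : rat} {tau : 'F_p} :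
  prime p -> reduces t tau ->
  odd (chi t p) <-> has_odd_order (companion tau).
Proof.
move=> p_pr ttau; have modE k := companion_mod k p_pr ttau.
rewrite /chi; split.
  case: xgetP => // k _ [_ /modE Dk1 _] odd_k.
  by exists k.
case=> k odd_k Dk1.
have k_gt0 : (0 < k)%N by case: k odd_k {Dk1}.
pose P j := (0 < j)%N && (companion tau ^+ j == 1).
have exP : exists j, P j by exists k; rewrite /P k_gt0 Dk1 eqxx.
have idx : is_index t p (ex_minn exP).
  case: ex_minnP => j /andP[j_gt0 /eqP Dj1] min_j; split=> //; first exact/modE.
  by move=> i i_gt0 /modE Di1; apply: min_j; rewrite /P i_gt0 Di1 eqxx.
case: xgetP => [c _ [c_gt0 /modE Dc1 min_c] | /(_ _ idx) //].
suff /dvdnP[q kE] : (c %| k)%N by move: odd_k; rewrite kE oddM => /andP[].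
rewrite /dvdn -leqn0 leqNgt; apply/negP=> r_gt0.
have /modE/(min_c _ r_gt0) : companion tau ^+ (k %% c) = 1.
  by rewrite -Dk1 [in RHS](divn_eq k c) exprD mulnC exprM Dc1 expr1n mul1r.
by rewrite leqNgt ltn_mod c_gt0.
Qed.

Lemma odd_chi_iter_dbl {p : nat} {t : rat} {tau : 'F_p} :
  prime p -> odd p -> reduces t tau ->
  odd (chi t p) <-> exists2 n : nat, (0 < n)%N & iter n dbl tau = tau.
Proof.
move=> p_pr odd_p ttau; rewrite (odd_chi p_pr ttau).
exact: (odd_order_iter_dbl odd_p (pchar_Fp p_pr) (companion_mulV tau)
  (companion_Vmul tau) (companion_addV tau)).
Qed.

(** * The two families of quadratic maps *)

Lemma iter_fE (t : rat) (n : nat) : iter n (f t) 0 = iter n dbl t - t.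
Proof.
elim: n => [|n IHn]; first by rewrite /= subrr.
by rewrite !iterS IHn /f subrK.
Qed.

Lemma iter_gE (s : rat) (n : nat) : iter n (g s) 0 = s ^+ (2 ^ n) - s.
Proof.
elim: n => [|n IHn]; first by rewrite expn0 expr1 subrr.
by rewrite iterS IHn /g subrK -exprM -expnSr.
Qed.

Lemma odd_prime_ge3 {p : nat} : prime p -> odd p = (3 <= p)%N.
Proof.
move=> p_pr; case: (even_prime p_pr) => [-> // | odd_p].
by rewrite odd_p odd_prime_gt2.
Qed.

Theorem mainTheorem14 :
  (forall t : rat,
     t <> 0 -> t <> 1 -> t <> -1 -> t <> 2 -> t <> -2 ->
     [set p : nat | Pi t p /\
        exists n : nat, (1 <= n)%N /\ divides_num p (iter n (f t) 0)]
     = Pi0_2 t)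
  /\
  (forall s : rat,
     s <> 0 -> s <> 1 -> s <> -1 ->
     [set p : nat | [/\ prime p, odd p,
        ~~ divides_num p s, ~~ divides_den p s &
        exists n : nat, (1 <= n)%N /\ divides_num p (iter n (g s) 0)]]
     = Pi0_2 (s + s^-1)).
Proof.
split=> [t _ _ _ _ _ | s /eqP s0 _ _].
  apply/seteqP; rewrite /Pi0_2; suff E p : Pi t p ->
    (exists n : nat, (1 <= n)%N /\ divides_num p (iter n (f t) 0)) <->
    odd (chi t p) by split=> p /= [Pp /(E _ Pp)].
  case=> p_pr p_ge3 pt; rewrite -odd_prime_ge3 // in p_ge3.
  have [tau ttau] := reduces_exists p_pr pt.
  rewrite (odd_chi_iter_dbl p_pr p_ge3 ttau).
  have num n : divides_num p (iter n (f t) 0) = (iter n dbl tau == tau).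
    by rewrite iter_fE -(reduces_eq p_pr (reduces_iter_dbl n ttau) ttau).
  split=> [[n [n_gt0]] | [n n_gt0 /eqP]]; first by rewrite num => /eqP; exists n.
  by exists n; rewrite num.
(* the conditions on the numerator and the denominator of s imply that p is in
   Pi (s + s^-1); by den_addV they are equivalent to it *)
have E p : prime p -> odd p -> ~~ divides_num p s -> ~~ divides_den p s ->
    ~~ divides_den p (s + s^-1) /\
    ((exists n : nat, (1 <= n)%N /\ divides_num p (iter n (g s) 0)) <->
    odd (chi (s + s^-1) p)).
  move=> p_pr odd_p pns pds; have [sigma ss] := reduces_exists p_pr pds.
  rewrite (reduces_num p_pr ss) in pns.
  have tt := reducesD ss (reducesV ss pns).
  split; first exact: (reduces_den p_pr tt).
  rewrite (odd_chi_iter_dbl p_pr odd_p tt).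
  have sV : sigma * sigma^-1 = 1 by rewrite divff.
  have Vs : sigma^-1 * sigma = 1 by rewrite mulVf.
  have tauA : sigma + sigma^-1 = (sigma + sigma^-1)%:A :> ('F_p)^o.
    by rewrite [RHS]mulr1.
  rewrite -(odd_order_iter_dbl (A := ('F_p)^o) odd_p (pchar_Fp p_pr) sV Vs tauA).
  have num n : divides_num p (iter n (g s) 0) = (sigma ^+ (2 ^ n) == sigma).
    by rewrite iter_gE -(reduces_eq p_pr (reducesX (2 ^ n) ss) ss).
  split=> [[n [n_gt0]] | [k odd_k sk1]].
    by rewrite num => /eqP; apply: (fixed_expr2_odd_order sV n_gt0).
  exists (totient k); rewrite totient_gt0 num (odd_order_fixed_expr2 odd_k sk1) eqxx.
  by case: k odd_k {sk1}.
apply/seteqP; split=> p /=.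
  case=> p_pr odd_p pns pds /(E p p_pr odd_p pns pds).2 ?.
  by split=> //; split; rewrite -?odd_prime_ge3 //; case: (E p p_pr odd_p pns pds).
case=> -[p_pr p_ge3 pt]; rewrite -odd_prime_ge3 // in p_ge3.
have /andP[pns pds] := den_addV p_pr s0 pt.
by move=> /(E p p_pr p_ge3 pns pds).2.
Qed.
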